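(* Let $S,\mathcal Z,h^{\mathcal Z},R$, $g_R=R^*h^{\mathcal Z}$, the auxiliary Riemannian metric $g^S$ on $S$ and the response Gram operator $G_R\in\Gamma(\operatorname{End}(TS))$ be as in the context. Then: (1) $G_R$ is smooth and self-adjoint with respect to $g^S$; (2) $G_R$ is positive semidefinite; (3) $\ker G_R=\ker R=\ker g_R$ (at every point of $S$); (4) on the complete-response locus $S_{\mathrm{comp}}=\{p\in S:\ker R_p=\{0\}\}$, $G_R$ is positive definite.
   Context: $S$ is a smooth finite-dimensional manifold parameterizing a smooth family $\{g_p\}_{p\in S}$ of normalized Einstein metrics on a fixed smooth manifold $M$. The family comes with the following given data, which is all that the statement uses: a smooth real vector bundle $\mathcal Z\to S$ of finite rank, a smooth positive-definite fibre metric $h^{\mathcal Z}$ on $\mathcal Z$, and a smooth vector bundle morphism $R:TS\to\mathcal Z$ over the identity of $S$, with fibre maps $R_p:T_pS\to\mathcal Z_p$. The response metric is $(g_R)_p(X,Y)=h^{\mathcal Z}_p(R_pX,R_pY)$, with $\ker(g_R)_p=\{X:(g_R)_p(X,Y)=0\ \forall Y\}$. Fix any (auxiliary) Riemannian metric $g^S$ on $S$. The response Gram operator $G_R$ is the unique bundle endomorphism of $TS$ with $g^S(G_RX,Y)=g_R(X,Y)$ for all tangent vectors $X,Y$ at the same point. *)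

(* Defs.v *)
From HB Require Import structures.
From mathcomp Require Import all_boot all_order all_algebra.
From mathcomp Require Import all_classical all_reals all_analysis.

Set Implicit Arguments.
Unset Strict Implicit.
Unset Printing Implicit Defensive.

Import Order.TTheory GRing.Theory Num.Theory.
Import numFieldNormedType.Exports.

Local Open Scope classical_set_scope.
Local Open Scope ring_scope.

(* C^k and C^oo maps on an open subset U of a normed space, by iterated
   Frechet differentials. V is meant to be finite-dimensional: then
   x |-> 'd f x is C^k iff x |-> 'd f x v is C^k for every v. *)
Fixpoint Ck_on (R : realType) (V W : normedModType R) (k : nat) (U : set V)
    (f : V -> W) : Prop :=
  if k is k'.+1 then
    (forall x, U x -> differentiable f x) /\
    (forall v, Ck_on k' U (fun x => 'd f x v))
  else forall x, U x -> {for x, continuous f}.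

Definition smooth_on (R : realType) (V W : normedModType R) (U : set V)
  (f : V -> W) : Prop := forall k, Ck_on k U f.

Section CkCalculus.
Context (R : realType).
Implicit Types (V W : normedModType R) (n k : nat).

Lemma near_eq_differentiable V W (f g : V -> W) x :
  (\near x, f x = g x) -> differentiable f x ->
  differentiable g x /\ 'd g x = 'd f x :> (V -> W).
Proof.
move=> fg df.
have fgx : f x = g x by exact: nbhs_singleton fg.
have fg0 : \forall h \near 0, f (h + x) = g (h + x).
  by move: fg; rewrite (near_shift 0 x) subr0.
have /eqaddoP fo := diff_locally df.
have go : g \o shift x = cst (g x) + 'd f x +o_ 0 id.
  apply/eqaddoP => e e0; near=> h.
  have -> : ((g \o shift x) - (cst (g x) + 'd f x)) h =
            ((f \o shift x) - (cst (f x) + 'd f x)) h.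
    rewrite !fctE /= fgx; congr (_ - _); apply/esym; near: h; exact: fg0.
  by near: h; exact: fo.
have dE : 'd g x = 'd f x :> (V -> W).
  by apply: diff_unique => //; exact: diff_continuous.
split=> //; apply/diff_locallyP; split; first by rewrite dE; exact: diff_continuous.
by rewrite dE.
Unshelve. all: by end_near. Qed.

Lemma near_open V (U : set V) (P : V -> Prop) x :
  open U -> U x -> (forall y, U y -> P y) -> \near x, P x.
Proof.
by move=> oU Ux UP; apply: filterS UP _; exact: open_nbhs_nbhs.
Qed.

Lemma Ck_sub V W k (U U' : set V) (f : V -> W) :
  U' `<=` U -> Ck_on k U f -> Ck_on k U' f.
Proof.
move=> UU'; elim: k f => [|k IH] f /=; first by move=> H x /UU'; exact: H.
by move=> [d H]; split=> [x /UU' /d//|v]; exact: IH.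
Qed.

Lemma Ck_ext V W k (U : set V) (f g : V -> W) : open U ->
  (forall x, U x -> f x = g x) -> Ck_on k U f -> Ck_on k U g.
Proof.
move=> oU; elim: k f g => [|k IH] f g fg /=.
  move=> H x Ux; rewrite /prop_for /continuous_at -(fg _ Ux); apply: cvg_trans (H x Ux).
  by apply: near_eq_cvg; apply: near_open oU Ux _ => y Uy; rewrite fg.
have nfg x : U x -> \near x, f x = g x by move=> Ux; exact: near_open oU Ux fg.
move=> [d H]; split=> [x Ux|v].
  by have [] := near_eq_differentiable (nfg x Ux) (d x Ux).
apply: IH (H v) => x Ux.
by have [_ ->] := near_eq_differentiable (nfg x Ux) (d x Ux).
Qed.

Lemma Ck_le V W k (U : set V) (f : V -> W) : Ck_on k.+1 U f -> Ck_on k U f.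
Proof.
elim: k f => [|k IH] f.
  by move=> [d _] x /d/differentiable_continuous.
by move=> [d H]; split=> // v; apply: IH; exact: H.
Qed.

Lemma Ck_cst V W k (U : set V) (c : W) : Ck_on k U (fun=> c : W).
Proof.
elim: k c => [|k IH] c /=; first by move=> x _; exact: cst_continuous.
split=> [x _|v]; first exact: differentiable_cst.
rewrite (_ : (fun x => _) = fun=> 0); first exact: IH.
by apply/funext => x; rewrite (@diff_cst _ V W).
Qed.

Lemma Ck_add V W k (U : set V) (f g : V -> W) : open U ->
  Ck_on k U f -> Ck_on k U g -> Ck_on k U (fun x => f x + g x).
Proof.
move=> oU; elim: k f g => [|k IH] f g /=.
  by move=> Hf Hg x Ux; apply: cvgD; [exact: Hf|exact: Hg].
move=> [df Hf] [dg Hg]; split=> [x Ux|v].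
  by apply: differentiableD; [exact: df|exact: dg].
apply: Ck_ext oU _ (IH _ _ (Hf v) (Hg v)) => x Ux.
by rewrite -[in RHS]/(f + g) diffD//; [exact: df|exact: dg].
Qed.

Lemma Ck_sum V W k (U : set V) n (f : 'I_n -> V -> W) : open U ->
  (forall i, Ck_on k U (f i)) -> Ck_on k U (fun x => \sum_i f i x).
Proof.
move=> oU H; have := index_enum 'I_n => s.
suff {s} : forall s, Ck_on k U (fun x => \sum_(i <- s) f i x) by apply.
elim=> [|i s IH].
  by under eq_fun do rewrite big_nil; exact: Ck_cst.
by under eq_fun do rewrite big_cons; exact: Ck_add.
Qed.

Lemma Ck_linear V W W' k (U : set V) (L : {linear W -> W'}) (f : V -> W) :
  open U -> continuous L -> Ck_on k U f -> Ck_on k U (L \o f).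
Proof.
move=> oU cL; elim: k f => [|k IH] f /=.
  by move=> H x Ux; apply: continuous_comp; [exact: H|exact: cL].
have dL y : differentiable L y by exact: linear_differentiable.
move=> [d H]; split=> [x Ux|v]; first exact: differentiable_comp (d x Ux) _.
apply: Ck_ext oU _ (IH _ (H v)) => x Ux.
by rewrite diff_comp//=; [rewrite diff_lin|exact: d].
Qed.

Lemma Ck_coord V m n k (U : set V) (f : V -> 'M[R]_(m, n)) i j : open U ->
  Ck_on k U f -> Ck_on k U (fun x => f x i j : R).
Proof.
move=> oU.
have @L : {linear 'M[R]_(m, n) -> R}.
  by exists (fun N : 'M[R]_(_, _) => N i j); do 2![eexists]; do ?[constructor];
     rewrite ?mxE// => ? *; rewrite ?mxE//; move=> ?; rewrite !mxE.
by apply: (@Ck_linear _ _ _ _ _ L) => //; exact: coord_continuous.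
Qed.

Lemma scale_diff V W (f : V -> R) (g : V -> W) x :
  differentiable f x -> differentiable g x ->
  differentiable (fun x => f x *: g x) x /\
  forall v, 'd (fun x => f x *: g x) x v = f x *: 'd g x v + 'd f x v *: g x.
Proof.
move=> df dg.
have bil : bilinear_for (GRing.Scale.Law.clone _ _ *:%R _)
    (GRing.Scale.Law.clone _ _ *:%R _) (@GRing.scale R W).
  split=> [u'|u] a y z /=; first by rewrite scalerDl scalerA.
  by rewrite scalerDr !scalerA mulrC.
pose bM := bilinear_isBilinear.Build R R W W _ _ (@GRing.scale R W) bil.
pose B : {bilinear R -> W -> W} := HB.pack (@GRing.scale R W) bM.
have cB : continuous (fun p : R * W => B p.1 p.2).
  by move=> p; exact: scale_continuous.
have -> : (fun x => f x *: g x) =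
  (fun p : R * W => B p.1 p.2) \o (fun y => (f y, g y)) by [].
have dp : differentiable (fun y => (f y, g y)) x by exact: differentiable_pair.
split; first by apply: differentiable_comp => //; exact: differentiable_bilin.
move=> v; rewrite diff_comp//; last exact: differentiable_bilin.
have /funeqP bE := @diff_bilin _ _ _ _ B (f x, g x) cB.
have /funeqP pE := diff_pair df dg.
by rewrite [LHS]bE pE.
Qed.

Lemma Ck_scale V W k (U : set V) (f : V -> R) (g : V -> W) : open U ->
  Ck_on k U f -> Ck_on k U g -> Ck_on k U (fun x => f x *: g x).
Proof.
move=> oU; elim: k f g => [|k IH] f g.
  by move=> Hf Hg x Ux; apply: cvgZ; [exact: Hf|exact: Hg].
move=> cf cg; have [[df Hf] [dg Hg]] := (cf, cg).
split=> [x Ux|v]; first by have [] := scale_diff (df x Ux) (dg x Ux).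
have h1 := IH _ _ (Ck_le cf) (Hg v).
have h2 := IH _ _ (Hf v) (Ck_le cg).
apply: Ck_ext oU _ (Ck_add oU h1 h2) => x Ux.
by have [_ ->] := scale_diff (df x Ux) (dg x Ux).
Qed.

Lemma Ck_comp V W n k (U : set V) (U' : set 'rV[R]_n) (f : V -> 'rV[R]_n)
    (g : 'rV[R]_n -> W) : open U -> (forall x, U x -> U' (f x)) ->
  Ck_on k U f -> Ck_on k U' g -> Ck_on k U (g \o f).
Proof.
move=> oU UU'; elim: k g => [|k IH] g.
  by move=> Hf Hg x Ux; apply: continuous_comp; [exact: Hf|exact/Hg/UU'].
move=> cf [dg Hg]; have [df Hf] := cf.
split=> [x Ux|v].
  by apply: differentiable_comp; [exact: df|exact/dg/UU'].
suff h : Ck_on k U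
  (fun x => \sum_j ('d f x v) 0 j *: 'd g (f x) (delta_mx 0 j)).
  apply: Ck_ext oU _ h => x Ux.
  have dfx := df x Ux; have dgx : differentiable g (f x) by exact/dg/UU'.
  rewrite (diff_comp dfx dgx).
  transitivity ('d g (f x) (\sum_j ('d f x v) 0 j *: delta_mx 0 j)).
    by rewrite linear_sum; apply: eq_bigr => j _; rewrite linearZ.
  by rewrite -row_sum_delta.
apply: Ck_sum => // j; apply: Ck_scale => //.
  by apply: (@Ck_coord V 1 n k U (fun x => 'd f x v) 0 j oU); exact: Hf.
exact: IH (Ck_le cf) (Hg _).
Qed.

Lemma smooth_comp V W n (U : set V) (U' : set 'rV[R]_n) (f : V -> 'rV[R]_n)
    (g : 'rV[R]_n -> W) : open U -> (forall x, U x -> U' (f x)) ->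
  smooth_on U f -> smooth_on U' g -> smooth_on U (g \o f).
Proof. by move=> oU UU' Hf Hg k; exact: Ck_comp oU UU' (Hf k) (Hg k). Qed.

Lemma Ck_matrix V m n k (U : set V) (f : V -> 'M[R]_(m, n)) : open U ->
  (forall i j, Ck_on k U (fun x => f x i j : R)) -> Ck_on k U f.
Proof.
move=> oU H.
have -> : f = fun x => \sum_i \sum_j f x i j *: delta_mx i j.
  by apply/funext => x; exact: matrix_sum_delta.
do 2![apply: Ck_sum => // ?]; apply: Ck_scale => //; exact: Ck_cst.
Qed.

End CkCalculus.

(* chart_map and chart_inv are total functions; only their values on
   chart_dom and on its image are meaningful. *)
Record chart (R : realType) (n : nat) (T : topologicalType) := Chart {
  chart_dom : set T;
  chart_map : T -> 'rV[R]_n;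
  chart_inv : 'rV[R]_n -> T;
  chart_open : open chart_dom;
  chart_open_image : open (chart_map @` chart_dom);
  chartK : forall p, chart_dom p -> chart_inv (chart_map p) = p;
  chart_continuous : forall p, chart_dom p -> {for p, continuous chart_map};
  chart_inv_continuous : forall x, (chart_map @` chart_dom) x ->
    {for x, continuous chart_inv} }.

(* The smooth structure is the one generated by the atlas (a family of charts,
   not assumed to be maximal). *)
Record manifold (R : realType) (n : nat) := Manifold {
  mfd_space :> topologicalType;
  mfd_hausdorff : hausdorff_space mfd_space;
  mfd_second_countable : @second_countable mfd_space;
  mfd_index : Type;
  mfd_chart : mfd_index -> chart R n mfd_space;
  mfd_cover : forall p, exists i, chart_dom (mfd_chart i) p;
  mfd_compat : forall i j,
    smooth_on
      (chart_map (mfd_chart i) @`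
         (chart_dom (mfd_chart i) `&` chart_dom (mfd_chart j)))
      (chart_map (mfd_chart j) \o chart_inv (mfd_chart i)) }.

Section Charts.
Context (R : realType) (n : nat) (S : manifold R n).
Implicit Types (p : S) (i j k : mfd_index S).

Definition cdom i : set S := chart_dom (mfd_chart i).
Definition cmap i : S -> 'rV[R]_n := chart_map (mfd_chart i).
Definition cinv i : 'rV[R]_n -> S := chart_inv (mfd_chart i).
Definition transition i j : 'rV[R]_n -> 'rV[R]_n := cmap j \o cinv i.

Definition smooth_map (V : normedModType R) (U : set S) (f : S -> V) : Prop :=
  forall i, smooth_on (cmap i @` (cdom i `&` U)) (f \o cinv i).

Lemma cmapK i p : cdom i p -> cinv i (cmap i p) = p.
Proof. exact: chartK. Qed.

Lemma open_cmap i (U : set S) : open U -> open (cmap i @` (cdom i `&` U)).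
Proof.
move=> oU; rewrite openE => x /= [p [ip Up] <-]; rewrite /interior.
have nd : \forall y \near cmap i p, (cmap i @` cdom i) y.
  apply: open_nbhs_nbhs; split; first exact: chart_open_image.
  by exists p.
have nU : \forall y \near cmap i p, U (cinv i y).
  apply: chart_inv_continuous; first by exists p.
  rewrite [X in nbhs X _](cmapK ip); exact: open_nbhs_nbhs.
apply: filterS2 nd nU => y [q iq <-]; rewrite cmapK// => Uq.
by exists q.
Qed.

Lemma transition_differentiable i j p : cdom i p -> cdom j p ->
  differentiable (transition i j) (cmap i p).
Proof. by move=> ip jp; apply: (mfd_compat i j 1).1; exists p. Qed.

Lemma diff_transition_id i p : cdom i p ->
  'd (transition i i) (cmap i p) = id :> ('rV[R]_n -> 'rV[R]_n).
Proof.
move=> ip.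
have h : \forall x \near cmap i p, x = transition i i x.
  have Up : (cmap i @` (cdom i `&` setT)) (cmap i p) by exists p.
  apply: near_open (open_cmap (i := i) openT) Up _.
  by move=> _ [q [iq _] <-]; rewrite /transition /= cmapK.
by have [_ ->] := near_eq_differentiable h (@ex_diff _ _ _ _ _ _ _ (is_diff_id _));
  rewrite diff_val.
Qed.

Lemma diff_transition_comp i j k p : cdom i p -> cdom j p -> cdom k p ->
  'd (transition j k) (cmap j p) \o 'd (transition i j) (cmap i p) =
  'd (transition i k) (cmap i p) :> ('rV[R]_n -> 'rV[R]_n).
Proof.
move=> ip jp kp.
have dij := transition_differentiable ip jp.
have E : transition i j (cmap i p) = cmap j p by rewrite /transition /= cmapK.
have djk := transition_differentiable jp kp.
have djk' : differentiable (transition j k) (transition i j (cmap i p)).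
  by rewrite E.
have dE := diff_comp dij djk'; rewrite [in RHS]E in dE; rewrite -dE.
have h : \forall x \near cmap i p,
    transition i k x = (transition j k \o transition i j) x.
  have Up : (cmap i @` (cdom i `&` cdom j)) (cmap i p) by exists p.
  apply: near_open (open_cmap (i := i) (chart_open (mfd_chart j))) Up _.
  by move=> _ [q [iq jq] <-]; rewrite /transition /= !(@cmapK i)// cmapK.
by have [] := near_eq_differentiable h (transition_differentiable ip kp).
Qed.

End Charts.

(* A rank-r vector bundle, given by its fibres and an atlas of local
   trivializations U_a x R^r -> E|_(U_a), linear on fibres, whose transition
   functions U_a `&` U_b -> GL_r(R) are smooth. lin1_mx is the matrix of a
   linear map acting on row vectors. *)
Record vbundle (R : realType) (n : nat) (S : manifold R n) (r : nat) :=
  VBundle {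
  fibre :> S -> lmodType R;
  triv_index : Type;
  triv_dom : triv_index -> set S;
  triv : forall (a : triv_index) (p : S), fibre p -> 'rV[R]_r;
  triv_inv : forall (a : triv_index) (p : S), 'rV[R]_r -> fibre p;
  triv_open : forall a, open (triv_dom a);
  triv_cover : forall p, exists a, triv_dom a p;
  triv_linear : forall a p, triv_dom a p -> linear (triv a (p := p));
  trivK : forall a p, triv_dom a p -> cancel (triv a (p := p)) (triv_inv a p);
  triv_invK : forall a p, triv_dom a p ->
    cancel (triv_inv a p) (triv a (p := p));
  triv_compat : forall a b,
    smooth_map (triv_dom a `&` triv_dom b)
      (fun p => lin1_mx (fun u => triv b (triv_inv a p u))) }.

Section Tangent.
Context (R : realType) (n : nat) (S : manifold R n).
Implicit Types (p : S) (i j k : mfd_index S).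

(* A tangent vector at p is a family of coordinate vectors v i, one for each
   chart i around p, related by the differentials of the chart transitions.
   Charts that do not contain p carry the dummy value 0. *)
Definition is_tangent p (v : mfd_index S -> 'rV[R]_n) : Prop :=
  (forall i, ~ cdom i p -> v i = 0) /\
  (forall i j, cdom i p -> cdom j p ->
     v j = 'd (transition i j) (cmap i p) (v i)).

Definition tangent_pred p : {pred (mfd_index S -> 'rV[R]_n)} :=
  fun v => `[< is_tangent p v >].

Lemma tangent_submod_closed p : submod_closed (tangent_pred p).
Proof.
split.
  by apply/asboolP; split => // i j _ _; rewrite /= linear0.
move=> a u v /asboolP[u0 uE] /asboolP[v0 vE]; apply/asboolP; split.
  by move=> i pi; rewrite !fctE u0// v0// scaler0 addr0.
by move=> i j pi pj; rewrite !fctE (uE i j)// (vE i j)// linearP.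
Qed.

HB.instance Definition _ p :=
  GRing.isSubmodClosed.Build _ _ (tangent_pred p) (tangent_submod_closed p).

Record tangent p := Tangent {
  tangent_coord :> mfd_index S -> 'rV[R]_n;
  tangentP : tangent_coord \in tangent_pred p }.

HB.instance Definition _ p := [isSub for @tangent_coord p].
HB.instance Definition _ p := [Choice of tangent p by <:].
HB.instance Definition _ p := [SubChoice_isSubLmodule of tangent p by <:].

(* The tangent vector at p with coordinates u in the chart i. *)
Definition tangent_family i p (u : 'rV[R]_n) : mfd_index S -> 'rV[R]_n :=
  fun j => if `[< cdom i p /\ cdom j p >]
           then 'd (transition i j) (cmap i p) u else 0.

Lemma tangent_familyP i p u : tangent_family i p u \in tangent_pred p.
Proof.
apply/asboolP; split => [j jp|j k jp kp]; rewrite /tangent_family.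
  by case: asboolP => // -[].
case: asboolP => [[ip _]|nk]; case: asboolP => [[ip' _]|nj].
- have /funeqP dE := diff_transition_comp ip jp kp; exact/esym/dE.
- by exfalso; apply: nj.
- by exfalso; apply: nk.
- by rewrite linear0.
Qed.

Definition tangent_of i p (u : 'rV[R]_n) : tangent p :=
  Tangent (tangent_familyP i p u).

Definition tangent_triv i p (v : tangent p) : 'rV[R]_n := tangent_coord v i.

Lemma tangent_triv_linear i p : linear (@tangent_triv i p).
Proof. by []. Qed.

Lemma tangent_trivK i p : cdom i p -> cancel (@tangent_triv i p) (tangent_of i p).
Proof.
move=> ip v; apply/val_inj/funext => j /=.
have /asboolP[v0 vE] := tangentP v.
rewrite /tangent_family; case: asboolP => [[_ jp]|nj]; first by rewrite -vE.
by rewrite v0// => jp; exact: nj.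
Qed.

Lemma tangent_ofK i p : cdom i p -> cancel (tangent_of i p) (@tangent_triv i p).
Proof.
move=> ip u; rewrite /tangent_triv /= /tangent_family; case: asboolP => [_|[]//].
by rewrite diff_transition_id.
Qed.

Lemma tangent_compat i j :
  smooth_map (cdom i `&` cdom j)
    (fun p => lin1_mx (fun u => tangent_triv j (tangent_of i p u))).
Proof.
move=> l k.
have oU : open (cmap l @` (cdom l `&` (cdom i `&` cdom j))).
  by apply: open_cmap; apply: openI; exact: chart_open.
have H u : Ck_on k (cmap l @` (cdom l `&` (cdom i `&` cdom j)))
    ((fun x => 'd (transition i j) x u) \o transition l i).
  apply: (@Ck_comp _ _ _ _ _ _ (cmap i @` (cdom i `&` cdom j))) => //.
  - move=> _ [q [lq [iq jq]] <-]; exists q => //.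
    by rewrite /transition /= cmapK.
  - apply: Ck_sub (mfd_compat l i k) => _ [q [lq [iq jq]] <-].
    by exists q.
  - exact: (mfd_compat i j k.+1).2.
apply: Ck_matrix => // s t.
have := H (delta_mx 0 s) => /(Ck_coord 0 t oU).
apply: Ck_ext => // _ [q [lq [iq jq]] <-] /=.
rewrite mxE /transition /= !cmapK// /tangent_triv /= /tangent_family.
by case: asboolP => // -[].
Qed.

Definition tangent_bundle : vbundle S n :=
  @VBundle R n S n (fun p => tangent p : lmodType R) (mfd_index S) (@cdom R n S)
    tangent_triv tangent_of (fun i => chart_open (mfd_chart i))
    (@mfd_cover R n S) (fun i p _ => @tangent_triv_linear i p)
    tangent_trivK tangent_ofK tangent_compat.

End Tangent.

Section BundleData.
Context (R : realType) (n : nat) (S : manifold R n).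

(* Smoothness as a map of total spaces: (p, u) |-> triv_inv a p u and the
   charts of S give coordinates (x, u) in R^n x R^r on the total space, and the
   base component of the map is the identity. *)
Definition smooth_morphism r s (E : vbundle S r) (F : vbundle S s)
    (A : forall p, E p -> F p) : Prop :=
  forall (i : mfd_index S) (a : triv_index E) (b : triv_index F),
    smooth_on
      [set xu : 'rV[R]_n * 'rV[R]_r |
        (cmap i @` (cdom i `&` (triv_dom a `&` triv_dom b))) xu.1]
      (fun xu => triv b (A (cinv i xu.1) (triv_inv a (cinv i xu.1) xu.2))).

Record bundle_morphism r s (E : vbundle S r) (F : vbundle S s) :=
  BundleMorphism {
  morphism_map :> forall p, {linear E p -> F p};
  morphism_smooth : smooth_morphism morphism_map }.

(* Smoothness of a section of End(E), in the trivializations of End(E) induced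
   by those of E. *)
Definition smooth_endomorphism r (E : vbundle S r)
    (A : forall p, {linear E p -> E p}) : Prop :=
  forall a : triv_index E,
    smooth_map (triv_dom a)
      (fun p => lin1_mx (fun u => triv a (A p (triv_inv a p u)))).

Definition smooth_form r (E : vbundle S r) (b : forall p, E p -> E p -> R) :
    Prop :=
  forall a : triv_index E,
    smooth_map (triv_dom a)
      (fun p => \matrix_(i < r, j < r)
         b p (triv_inv a p (delta_mx 0 i)) (triv_inv a p (delta_mx 0 j))).

Record fibre_metric r (E : vbundle S r) := FibreMetric {
  metric_form :> forall p, E p -> E p -> R;
  metric_linear : forall p Y, scalar (fun X : E p => metric_form X Y);
  metric_sym : forall p (X Y : E p), metric_form X Y = metric_form Y X;
  metric_pos : forall p (X : E p), X != 0 -> 0 < metric_form X X;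
  metric_smooth : smooth_form metric_form }.

Definition riemannian_metric := fibre_metric (tangent_bundle S).

End BundleData.

Section GramOperator.
Context (R : realType) (n : nat) (S : manifold R n) (r : nat).
Context (E : vbundle S r) (g : fibre_metric E).

Lemma triv0 a p : triv_dom a p -> triv a (0 : E p) = 0.
Proof.
move=> ap; have := triv_linear ap (-1) 0 0.
by rewrite scaler0 addr0 scaleN1r addNr.
Qed.

Lemma triv_inv_linear a p : triv_dom a p -> linear (@triv_inv _ _ _ _ E a p).
Proof.
move=> ap c u v; rewrite -[LHS](trivK ap) -[RHS](trivK ap) ; congr triv_inv.
by rewrite triv_linear// !triv_invK.
Qed.

(* Every linear functional on a fibre is represented by the fibre metric. *)
Lemma riesz p (f : E p -> R) : scalar f -> exists Z, forall Y, g p Z Y = f Y.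
Proof.
move=> fl; have [a ap] := triv_cover E p.
pose e i : E p := triv_inv a p (delta_mx 0 i).
pose til := GRing.isLinear.Build _ _ _ _ _ (triv_inv_linear ap).
pose ti : {linear 'rV[R]_r -> E p} := HB.pack (triv_inv a p) til.
pose fL : {linear E p -> R^o} :=
  HB.pack f (GRing.isLinear.Build R (E p) R^o _ f fl).
pose gL Y : {linear E p -> R^o} := HB.pack (fun X => g p X Y)
  (GRing.isLinear.Build R (E p) R^o _ _ (metric_linear g Y)).
have expand X : X = \sum_i triv a X 0 i *: e i.
  rewrite -[LHS](trivK ap) -[triv_inv a p _]/(ti _) {1}(row_sum_delta (triv a X)).
  by rewrite linear_sum; apply: eq_bigr => i _; rewrite linearZ.
pose B : 'M[R]_r := \matrix_(i, j) g p (e i) (e j).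
have gB u Y : g p (ti u) Y = \sum_i u 0 i * g p (e i) Y.
  rewrite -[LHS]/(gL Y _) {1}(row_sum_delta u) !linear_sum.
  by apply: eq_bigr => i _; rewrite !linearZ.
have Bu : B \in unitmx.
  rewrite -row_free_unit -kermx_eq0; apply/eqP/row_matrixP => l.
  rewrite row0; set u := row l _.
  have uB : u *m B = 0 by apply/sub_kermxP; exact: row_sub.
  apply/eqP/negPn/negP => u0.
  have tu0 : ti u != 0.
    by apply: contra u0 => /eqP h; rewrite -(triv_invK ap u) -[triv_inv a p u]/(ti u) h triv0.
  have := metric_pos g tu0; rewrite gB big1 ?ltxx// => i _.
  have -> : g p (e i) (ti u) = (u *m B) 0 i.
    rewrite metric_sym gB [RHS]mxE.
    by apply: eq_bigr => j _; rewrite [B _ _]mxE.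
  by rewrite uB [X in _ * X]mxE mulr0.
pose w : 'rV[R]_r := (\row_i f (e i)) *m invmx B.
exists (ti w) => Y.
have wB j : g p (ti w) (e j) = f (e j).
  have -> : g p (ti w) (e j) = (w *m B) 0 j.
    by rewrite gB [RHS]mxE; apply: eq_bigr => i _; rewrite [B _ _]mxE.
  by rewrite mulmxKV// mxE.
rewrite metric_sym {1}(expand Y) -[LHS]/(gL _ _) -[RHS]/(fL _) [in RHS](expand Y).
rewrite !linear_sum; apply: eq_bigr => i _; rewrite !linearZ /=.
by rewrite metric_sym wB.
Qed.

Lemma metric_inj p (X X' : E p) : (forall Y, g p X Y = g p X' Y) -> X = X'.
Proof.
move=> h; apply/eqP; rewrite -subr_eq0; apply/negPn/negP => d0.
have := metric_pos g d0.
rewrite -(addrC (- X')) -scaleN1r metric_linear h mulN1r addNr.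
by rewrite ltxx.
Qed.

Context (b : forall p, E p -> E p -> R).
Hypothesis b_linearl : forall p Y, scalar (fun X : E p => b X Y).
Hypothesis b_linearr : forall p X, scalar (fun Y : E p => b X Y).

(* The endomorphism A with g (A X) Y = b X Y, see gram_operatorE and
   gram_operator_unique. *)
Definition gram_fun p (X : E p) : E p :=
  projT1 (cid (riesz (b_linearr X))).

Lemma gram_funE p (X Y : E p) : g p (gram_fun X) Y = b X Y.
Proof. by rewrite /gram_fun; case: cid. Qed.

Lemma gram_fun_linear p : linear (@gram_fun p).
Proof.
move=> c X X'; apply: metric_inj => Y.
by rewrite metric_linear !gram_funE b_linearl.
Qed.

Definition gram_operator p : {linear E p -> E p} :=
  HB.pack (@gram_fun p)
    (GRing.isLinear.Build _ _ _ _ (@gram_fun p) (@gram_fun_linear p)).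

Lemma gram_operatorE p (X Y : E p) : g p (gram_operator p X) Y = b X Y.
Proof. exact: gram_funE. Qed.

Lemma gram_operator_unique (A : forall p, E p -> E p) :
  (forall p (X Y : E p), g p (A p X) Y = b X Y) ->
  forall p (X : E p), A p X = gram_operator p X.
Proof.
by move=> h p X; apply: metric_inj => Y; rewrite h gram_operatorE.
Qed.

End GramOperator.

Section Response.
Context (R : realType) (n r : nat) (S : manifold R n) (Z : vbundle S r).
Context (h : fibre_metric Z) (rsp : bundle_morphism (tangent_bundle S) Z).

Definition response_metric p (X Y : tangent p) : R := h p (rsp p X) (rsp p Y).

Lemma response_linearl p (Y : tangent p) :
  scalar (fun X : tangent p => response_metric X Y).
Proof. by move=> c X X'; rewrite /response_metric linearP metric_linear. Qed.

Lemma response_linearr p (X : tangent p) :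
  scalar (fun Y : tangent p => response_metric X Y).
Proof.
move=> c Y Y'; rewrite /response_metric linearP metric_sym metric_linear.
by rewrite !(metric_sym h (rsp p X)).
Qed.

Definition response_gram (gS : riemannian_metric S) (p : S) :
    {linear tangent p -> tangent p} :=
  gram_operator gS response_linearl response_linearr p.

Lemma response_gramE (gS : riemannian_metric S) p (X Y : tangent p) :
  gS p (response_gram gS p X) Y = response_metric X Y.
Proof. exact: gram_operatorE. Qed.

Definition response_metric_ker (p : S) : set (tangent p) :=
  [set X | forall Y, response_metric X Y = 0].

Definition complete_response_locus : set S :=
  [set p | [set X : tangent p | rsp p X = 0] = [set 0]].

End Response.

Arguments response_metric_ker {R n r S Z} h rsp p.

(* Main.v *)
(** In a local frame of TS, let B and C be the Gram matrices of g^S and of g_R.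
    The matrix of G_R, acting on row vectors, is C B^-1, and C = M H M^T with M
    the matrix of R and H that of h^Z in a local frame of Z; since B is
    invertible, Cramer's formula makes C B^-1 smooth. The pointwise claims
    follow from g^S(G_R X, Y) = h^Z(R X, R Y) and definiteness of h^Z. *)

From HB Require Import structures.
Require Import Defs.
From mathcomp Require Import all_boot all_order all_algebra.
From mathcomp Require Import all_classical all_reals all_analysis.

Import Order.TTheory GRing.Theory Num.Theory.
Import numFieldNormedType.Exports.

Local Open Scope classical_set_scope.
Local Open Scope ring_scope.

(** * Closure of C^k maps under products, matrix inverses and slicing *)

Section CkCalculus.
Set Implicit Arguments.
Unset Strict Implicit.
Context (R : realType).
Implicit Types (V W : normedModType R) (k n : nat).

(** Each clause of [Ck_on] is a condition at a single point, with differentials taken in the ambient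
    space, so [U'] may vary with the point. *)
Lemma Ck_local V W k (U : set V) (f : V -> W) :
  (forall x, U x -> exists2 U' : set V, U' x & Ck_on k U' f) -> Ck_on k U f.
Proof.
elim: k f => [|k IH] f loc /=.
  by move=> x /loc[U' U'x H]; exact: H.
split=> [x /loc[U' U'x [d _]]|v]; first exact: d.
by apply: IH => x /loc[U' U'x [_ H]]; exists U' => //; exact: H.
Qed.

Lemma Ck_big_sum V W k (U : set V) (I : Type) (s : seq I) (P : pred I)
    (f : I -> V -> W) : open U -> (forall i, Ck_on k U (f i)) ->
  Ck_on k U (fun x => \sum_(i <- s | P i) f i x).
Proof.
move=> oU H; elim: s => [|i s IH].
  by under eq_fun do rewrite big_nil; exact: Ck_cst.
under eq_fun do rewrite big_cons.
by case: (P i) => //; exact: Ck_add.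
Qed.

Lemma Ck_mul V k (U : set V) (f g : V -> R) : open U ->
  Ck_on k U f -> Ck_on k U g -> Ck_on k U (fun x => f x * g x : R).
Proof. exact: (@Ck_scale R V R^o). Qed.

Lemma Ck_prod V k (U : set V) (I : Type) (s : seq I) (P : pred I)
    (f : I -> V -> R) : open U -> (forall i, Ck_on k U (f i)) ->
  Ck_on k U (fun x => \prod_(i <- s | P i) f i x : R).
Proof.
move=> oU H; elim: s => [|i s IH].
  by under eq_fun do rewrite big_nil; exact: Ck_cst.
under eq_fun do rewrite big_cons.
by case: (P i) => //; exact: Ck_mul.
Qed.

(** Induction on [k]: the derivative of 1/f is -f^-2 f', and its factor f^-1 is already C^k by the
    induction hypothesis. *)
Lemma Ck_inv V k (U : set V) (f : V -> R) : open U ->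
  (forall x, U x -> f x != 0) -> Ck_on k U f ->
  Ck_on k U (fun x => (f x)^-1 : R).
Proof.
move=> oU f0; elim: k => [|k IH].
  by move=> Hf x Ux; apply: cvgV; [exact: f0|exact: Hf].
move=> cf; have [df Hf] := cf; have cV := IH (Ck_le cf).
split=> [x Ux|v]; first by apply: differentiableV; [exact: df|exact: f0].
apply: Ck_ext oU _
  (Ck_mul oU (Ck_mul oU (Ck_cst k U (-1 : R)) (Ck_mul oU cV cV)) (Hf v)) => x Ux.
by rewrite (diffV (df x Ux) (f0 x Ux)) /= -exprVn expr2 mulN1r.
Qed.

Lemma Ck_mulmx V k (U : set V) m n p (A : V -> 'M[R]_(m, n))
    (B : V -> 'M[R]_(n, p)) : open U ->
  Ck_on k U A -> Ck_on k U B -> Ck_on k U (fun x => A x *m B x).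
Proof.
move=> oU cA cB; apply: Ck_matrix => // i j.
under eq_fun do rewrite mxE.
by apply: Ck_big_sum => // l; apply: Ck_mul => //; exact: Ck_coord.
Qed.

Lemma Ck_trmx V k (U : set V) m n (A : V -> 'M[R]_(m, n)) : open U ->
  Ck_on k U A -> Ck_on k U (fun x => (A x)^T).
Proof.
move=> oU cA; apply: Ck_matrix => // i j.
by under eq_fun do rewrite mxE; exact: Ck_coord.
Qed.

Lemma Ck_det V k (U : set V) n (A : V -> 'M[R]_n) : open U ->
  Ck_on k U A -> Ck_on k U (fun x => \det (A x) : R).
Proof.
move=> oU cA; apply: Ck_big_sum => // s; apply: Ck_mul => //.
  exact: Ck_cst.
by apply: Ck_prod => // i; exact: Ck_coord.
Qed.

Lemma Ck_invmx V k (U : set V) n (A : V -> 'M[R]_n) : open U ->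
  (forall x, U x -> A x \in unitmx) ->
  Ck_on k U A -> Ck_on k U (fun x => invmx (A x)).
Proof.
move=> oU uA cA; apply: Ck_matrix => // i j.
have cdet : Ck_on k U (fun x => (\det (A x))^-1 : R).
  apply: Ck_inv => //; last exact: Ck_det.
  by move=> x /uA; rewrite unitmxE unitfE.
have cadj : Ck_on k U (fun x => (\adj (A x)) i j : R).
  under eq_fun do rewrite mxE; apply: Ck_mul => //; first exact: Ck_cst.
  apply: Ck_det => //; apply: Ck_matrix => // s t.
  by under eq_fun do rewrite !mxE; exact: Ck_coord.
apply: Ck_ext oU _ (Ck_mul oU cdet cadj) => x Ux.
by rewrite /invmx uA// [in RHS]mxE.
Qed.

(** Bundle morphisms are smooth jointly in the base and fibre coordinates; freezing the fibre
    coordinate yields smooth matrix entries. *)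
Lemma Ck_slice V1 V2 W k (U : set (V1 * V2)) (u : V2) (f : V1 * V2 -> W) :
  open [set x | U (x, u)] ->
  Ck_on k U f -> Ck_on k [set x | U (x, u)] (fun x => f (x, u)).
Proof.
move=> oU; elim: k f => [|k IH] f.
  move=> Hf x Ux; apply: (continuous_comp (f := fun x => (x, u)) (g := f)).
    apply: cvg_pair => //=; exact: cvg_cst.
  exact: Hf.
move=> [df Hf].
have dp x : differentiable (fun x : V1 => (x, u)) x.
  exact: differentiable_pair.
split=> [x Ux|v].
  by apply: (differentiable_comp (f := fun x => (x, u)) (g := f)) => //; exact: df.
(* The second coordinate is constant along the slice, so direction [v] lifts to [(v, 0)]. *)
apply: Ck_ext oU _ (IH _ (Hf (v, 0))) => x Ux.
rewrite (diff_comp (f := fun x => (x, u)) (g := f))//=; last exact: df.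
rewrite diff_pair//=.
by rewrite -[fun=> u]/(cst u) !diff_val.
Qed.

End CkCalculus.

(** * Forms and operators as matrices in local frames *)

Section SmoothForms.
Set Implicit Arguments.
Unset Strict Implicit.
Context (R : realType) (n : nat) (S : manifold R n).

Definition frame r (E : vbundle S r) (a : triv_index E) (p : S) (i : 'I_r) :
  E p := triv_inv a p (delta_mx 0 i).

(** Convertible to the matrix in [smooth_form], so [metric_smooth] applies to it directly. *)
Definition form_mx r (E : vbundle S r) (a : triv_index E) (p : S)
    (b : E p -> E p -> R) : 'M[R]_r :=
  \matrix_(i, j) b (frame a p i) (frame a p j).

Lemma scalar_frame r (E : vbundle S r) (a : triv_index E) p (f : E p -> R)
    (X : E p) : triv_dom a p -> scalar f ->
  f X = \sum_i triv a X 0 i * f (frame a p i).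
Proof.
move=> ap fl.
pose til := GRing.isLinear.Build _ _ _ _ _ (triv_inv_linear ap).
pose ti : {linear 'rV[R]_r -> E p} := HB.pack (triv_inv a p) til.
pose fL : {linear E p -> R^o} :=
  HB.pack f (GRing.isLinear.Build R (E p) R^o _ f fl).
rewrite -[LHS]/(fL X) -{1}(trivK ap X) {1}(row_sum_delta (triv a X)).
rewrite -[triv_inv a p _]/(ti _) !linear_sum.
by apply: eq_bigr => i _; rewrite !linearZ.
Qed.

Lemma metric_scalarr r (E : vbundle S r) (g : fibre_metric E) p (X : E p) :
  scalar (g p X).
Proof. by move=> c Y Y'; rewrite Defs.metric_sym metric_linear !(Defs.metric_sym g X). Qed.

(** A row [u] in the kernel of the Gram matrix is the coordinate vector of some [X] orthogonal to
    the whole frame, hence to itself; definiteness gives [X = 0] and so [u = 0]. *)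
Lemma metric_form_mx_unit r (E : vbundle S r) (g : fibre_metric E)
    (a : triv_index E) p : triv_dom a p -> form_mx a (g p) \in unitmx.
Proof.
move=> ap; rewrite -row_free_unit -kermx_eq0; apply/eqP/row_matrixP => l.
rewrite row0; set u := row l _.
have uB : u *m form_mx a (g p) = 0 by apply/sub_kermxP; exact: row_sub.
pose X : E p := triv_inv a p u.
have gX t : g p X (frame a p t) = 0.
  rewrite (@scalar_frame _ _ a p (fun Y => g p Y _) X ap (metric_linear g _)).
  transitivity ((u *m form_mx a (g p)) 0 t); last by rewrite uB mxE.
  rewrite mxE; apply: eq_bigr => i _.
  by rewrite triv_invK// [form_mx _ _ _ _]mxE.
have gXX : g p X X = 0.
  rewrite (scalar_frame X ap (metric_scalarr g X)) big1// => i _.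
  by rewrite gX mulr0.
have X0 : X = 0.
  by apply/eqP/negPn/negP => /(metric_pos g); rewrite gXX ltxx.
by rewrite -(triv_invK ap u) -/X X0 triv0.
Qed.

Lemma smooth_gram_operator r (E : vbundle S r) (g : fibre_metric E)
    (b : forall p, E p -> E p -> R)
    (bl : forall p Y, scalar (fun X : E p => b p X Y))
    (br : forall p X, scalar (fun Y : E p => b p X Y)) :
  smooth_form b -> smooth_endomorphism (gram_operator g bl br).
Proof.
move=> sb a i k.
have oU : open (cmap i @` (cdom i `&` triv_dom a)).
  by apply: open_cmap; exact: triv_open.
have uB x : (cmap i @` (cdom i `&` triv_dom a)) x ->
    form_mx a (g (cinv i x)) \in unitmx.
  by move=> [p [ip ap] <-]; rewrite cmapK//; exact: metric_form_mx_unit.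
have cB := Ck_invmx oU uB (metric_smooth g a i k).
apply: Ck_ext oU _ (Ck_mulmx oU (sb a i k) cB) => _ [p [ip ap] <-].
rewrite /= cmapK// -[X in X *m _]/(form_mx a (b p)).
(* With A the matrix of the operator, A = C B^-1 becomes C = A B; entrywise this is b(e_s, e_t) =
   g(A e_s, e_t) with A e_s expanded in the frame. *)
apply: (canLR (mulmxK (metric_form_mx_unit g ap))).
apply/matrixP => s t; rewrite !mxE -(gram_operatorE g bl br).
rewrite (@scalar_frame _ _ a p (fun Y => g p Y _) _ ap (metric_linear g _)).
by apply: eq_bigr => l _; rewrite !mxE.
Qed.

Lemma smooth_morphism_frame r s (E : vbundle S r) (F : vbundle S s)
    (A : bundle_morphism E F) (a : triv_index E) (b : triv_index F) :
  smooth_map (triv_dom a `&` triv_dom b)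
    (fun p => \matrix_i triv b (A p (frame a p i))).
Proof.
move=> i k.
have oU : open (cmap i @` (cdom i `&` (triv_dom a `&` triv_dom b))).
  by apply: open_cmap; apply: openI; exact: triv_open.
apply: Ck_matrix => // l t.
(* Row [l] of the matrix is the morphism in coordinates, restricted to the fibre coordinate
   [delta_mx 0 l]. *)
have := Ck_slice (u := delta_mx 0 l) _ (morphism_smooth A i a b k) => /(_ oU).
move=> /(Ck_coord 0 t oU); apply: Ck_ext => // x _.
by rewrite /= mxE.
Qed.

Lemma smooth_form_pullback r s (E : vbundle S r) (F : vbundle S s)
    (A : bundle_morphism E F) (h : fibre_metric F) :
  smooth_form (fun p (X Y : E p) => h p (A p X) (A p Y)).
Proof.
(* A trivialization of [F] may cover only part of [triv_dom a], so smoothness is checked near each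
   point, on the overlap with some [triv_dom b]. *)
move=> a i k; apply: Ck_local => _ [p [ip ap] <-].
have [b bp] := triv_cover F p.
exists (cmap i @` (cdom i `&` (triv_dom a `&` triv_dom b))); first by exists p.
have oU : open (cmap i @` (cdom i `&` (triv_dom a `&` triv_dom b))).
  by apply: open_cmap; apply: openI; exact: triv_open.
have cM := smooth_morphism_frame A a b i k.
have cH : Ck_on k (cmap i @` (cdom i `&` (triv_dom a `&` triv_dom b)))
    (fun x => form_mx b (h (cinv i x))).
  by apply: Ck_sub (metric_smooth h b i k) => _ [q [iq [aq bq]] <-]; exists q.
apply: Ck_ext oU _ (Ck_mulmx oU (Ck_mulmx oU cM cH) (Ck_trmx oU cM)).
move=> _ [q [iq [aq bq]] <-]; rewrite /= cmapK//.
apply/matrixP => l t; rewrite [LHS]mxE [RHS]mxE -/(frame a q l) -/(frame a q t).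
(* The second argument is expanded in the frame of [F], producing the factor M^T; expanding the
   first one below produces M H. *)
rewrite (scalar_frame _ bq (metric_scalarr h _)).
apply: eq_bigr => j _; rewrite [(_^T) _ _]mxE [in X in _ * X = _]mxE mulrC.
congr (_ * _).
rewrite (@scalar_frame _ _ b q (fun Y => h q Y _) _ bq (metric_linear h _)).
by rewrite mxE; apply: eq_bigr => m _; rewrite !mxE.
Qed.

End SmoothForms.

Theorem proposition4p2 (R : realType) (n r : nat) (S : manifold R n)
    (Z : vbundle S r) (h : fibre_metric Z)
    (rsp : bundle_morphism (tangent_bundle S) Z) (gS : riemannian_metric S) :
  let G := response_gram h rsp gS in
  [/\ smooth_endomorphism (E := tangent_bundle S) G /\
      (forall (p : S) (X Y : tangent p), gS p (G p X) Y = gS p X (G p Y)),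
      (forall (p : S) (X : tangent p), 0 <= gS p (G p X) X),
      (forall p : S,
         [set X : tangent p | G p X = 0] = [set X : tangent p | rsp p X = 0] /\
         [set X : tangent p | rsp p X = 0] = response_metric_ker h rsp p)
    & (forall p : S, complete_response_locus rsp p ->
         forall X : tangent p, X != 0 -> 0 < gS p (G p X) X)].
Proof.
move=> G.
have metric0 r' (E : vbundle S r') (g : fibre_metric E) p (X : E p) :
    g p 0 X = 0.
  by have := metric_linear g X (-1) 0 0; rewrite scaler0 addr0 mulN1r addNr.
have h_ge0 p (X : tangent p) : 0 <= response_metric h rsp X X.
  rewrite /response_metric; have [->|/(metric_pos h)/ltW//] := eqVneq (rsp p X) 0.
  by rewrite metric0.
(* Definiteness of [h] is what makes isotropic vectors of the response metric lie in the kernel of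
   [rsp]; the kernel equalities and strict positivity rest on it. *)
have h_eq0 p (X : tangent p) : response_metric h rsp X X = 0 -> rsp p X = 0.
  by move=> X0; apply/eqP/negPn/negP => /(metric_pos h); rewrite [h p _ _]X0 ltxx.
split.
- split; first exact/smooth_gram_operator/smooth_form_pullback.
  (* Both sides become values of the response metric, which inherits its symmetry from [h]. *)
  move=> p X Y; rewrite [RHS]Defs.metric_sym !response_gramE.
  exact: Defs.metric_sym.
- by move=> p X; rewrite response_gramE.
- move=> p; split; apply/seteqP; split=> X /=.
  + by move=> GX0; apply: h_eq0; rewrite -(response_gramE _ _ gS) [response_gram _ _ _ _ _]GX0 metric0.
  (* Nondegeneracy of [gS]: it suffices that [G p X] pairs to 0 with every [Y]. *)
  + move=> RX0; apply: (metric_inj (g := gS)) => Y.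
    by rewrite response_gramE /response_metric RX0 !metric0.
  + by move=> RX0 Y; rewrite /response_metric RX0 metric0.
  + by move=> /(_ X); exact: h_eq0.
(* Given semidefiniteness, only a zero value has to be excluded; it would force [rsp p X = 0], hence
   [X = 0] on this locus. *)
- move=> p kerR X X0; rewrite response_gramE lt_neqAle h_ge0 andbT eq_sym.
  apply: contra X0 => /eqP/h_eq0 RX0.
  by have /seteqP[/(_ X RX0)/= -> _] := kerR.
Qed.
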